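(* Let $r,s\ge0$ be integers and let $x,y$ be distinct vertices of $B_{r,s}=P_3^{\square r}\square Q_s$. Suppose that at least one of $x,y$ is not a corner and that $H=B_{r,s}-\{x,y\}$ is nonempty and is not an isometric subgraph of $B_{r,s}$. If $H$ is a partial cube, then $r+s\le3$.
   Context: Graphs are finite and simple; partial cubes are connected by convention. $P_3$ is the path on three vertices, $Q_s$ the hypercube on $\{0,1\}^s$, $\square$ the Cartesian product, $G^{\square0}=Q_0=K_1$. Coordinate model: $V(B_{r,s})=\{0,1,2\}^r\times\{0,1\}^s$, two vertices being adjacent iff they differ in exactly one coordinate and there by exactly $1$. A corner is a vertex whose first $r$ coordinates all lie in $\{0,2\}$. $B_{r,s}-\{x,y\}$ is the subgraph induced by the remaining vertices. A subgraph $H$ of $G$ is isometric if $d_H(u,v)=d_G(u,v)$ for all $u,v\in V(H)$. A partial cube is a graph isomorphic to an isometric subgraph of a hypercube. *)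

(* Defs.v *)
From mathcomp Require Import all_boot.

Set Implicit Arguments.
Unset Strict Implicit.
Unset Printing Implicit Defensive.

(** * Finite simple graphs *)

Record sgraph := SGraph {
  vertex :> finType;
  edge : rel vertex;
  edge_sym : symmetric edge;
  edge_irr : irreflexive edge }.

Definition graph_iso (G H : sgraph) : Prop :=
  exists2 f : G -> H, bijective f & forall u v, edge (f u) (f v) = edge u v.

(** * Distance *)

Definition walk (G : sgraph) (n : nat) (u v : G) : bool :=
  [exists p : n.-tuple G, path (@edge G) u p && (v == last u p)].

Lemma connect_walk (G : sgraph) (u v : G) :
  connect (@edge G) u v -> exists n, walk n u v.
Proof.
case/connectP=> p up ->; exists (size p).
by apply/existsP; exists (in_tuple p); rewrite /= up eqxx.
Qed.

(* [None] is the infinite distance between different components. *)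
Definition dist (G : sgraph) (u v : G) : option nat :=
  match @idP (connect (@edge G) u v) with
  | ReflectT uv => Some (ex_minn (connect_walk uv))
  | ReflectF _ => None
  end.

Lemma dist_SomeP (G : sgraph) (u v : G) (n : nat) :
  dist u v = Some n <-> walk n u v /\ (forall m, walk m u v -> n <= m).
Proof.
rewrite /dist; case: {-}_ / idP => [uv | nuv]; last first.
  split=> // -[/existsP[p /andP[up /eqP v_last]] _].
  by case: nuv; apply/connectP; exists p.
case: ex_minnP => m wm minm; split=> [[<-] // | [wn minn]].
by congr Some; apply/eqP; rewrite eqn_leq minm // minn.
Qed.

Lemma dist_NoneP (G : sgraph) (u v : G) :
  dist u v = None <-> forall n, ~~ walk n u v.
Proof.
rewrite /dist; case: {-}_ / idP => [uv | nuv]; split=> //.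
  by case: (connect_walk uv) => n wn /(_ n); rewrite wn.
move=> _ n; apply/negP=> /existsP[p /andP[up /eqP v_last]].
by case: nuv; apply/connectP; exists p.
Qed.

(** * Subgraphs *)

Record subgraph (G : sgraph) := SubGraph {
  sverts : {set G};
  sedge : rel G;
  sedge_sym : symmetric sedge;
  sedge_sub : forall u v, sedge u v -> [&& u \in sverts, v \in sverts & edge u v] }.

Section SubgraphAsGraph.
Variables (G : sgraph) (H : subgraph G).
Let T : finType := {u : G | u \in sverts H}.
Let e : rel T := fun u v => sedge H (val u) (val v).

Fact subgraph_edge_sym : symmetric e.
Proof. by move=> u v; apply: sedge_sym. Qed.

Fact subgraph_edge_irr : irreflexive e.
Proof. by move=> u; apply/negP=> /sedge_sub; rewrite edge_irr !andbF. Qed.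

Definition graph_of_subgraph : sgraph :=
  SGraph subgraph_edge_sym subgraph_edge_irr.
End SubgraphAsGraph.

Coercion graph_of_subgraph : subgraph >-> sgraph.

Section Induced.
Variables (G : sgraph) (S : {set G}).
Let e : rel G := fun u v => [&& u \in S, v \in S & edge u v].

Fact induced_sym : symmetric e.
Proof. by move=> u v; rewrite /e edge_sym andbCA. Qed.

Definition induced : subgraph G :=
  SubGraph induced_sym (fun u v (uv : e u v) => uv).
End Induced.

Definition isometric (G : sgraph) (H : subgraph G) : Prop :=
  forall u v : H, dist u v = dist (val u) (val v).

(** * Cartesian products *)

Section Path.
Variable n : nat.
Let e : rel 'I_n := fun i j => (i.+1 == j :> nat) || (j.+1 == i :> nat).

Fact path_sym : symmetric e. Proof. by move=> i j; rewrite /e orbC. Qed.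
Fact path_irr : irreflexive e.
Proof. by move=> i; rewrite /e orbb gtn_eqF. Qed.

Definition path_graph : sgraph := SGraph path_sym path_irr.
End Path.

Section Box.
Variables G H : sgraph.
Let e : rel (G * H)%type := fun x y =>
  (edge x.1 y.1 && (x.2 == y.2)) || ((x.1 == y.1) && edge x.2 y.2).

Fact box_sym : symmetric e.
Proof.
by move=> x y; rewrite /e !(edge_sym x.1, edge_sym x.2) !(eq_sym y.1, eq_sym y.2).
Qed.

Fact box_irr : irreflexive e.
Proof. by move=> x; rewrite /e !edge_irr andbF. Qed.

Definition box : sgraph := SGraph box_sym box_irr.
End Box.

(* The zeroth power has the empty function as its only vertex. *)
Section BoxPower.
Variables (G : sgraph) (n : nat).
Let e : rel {ffun 'I_n -> G} := fun x y =>
  [exists i, edge (x i) (y i) && [forall j, (j != i) ==> (x j == y j)]].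

Fact box_pow_sym : symmetric e.
Proof.
move=> x y; apply: eq_existsb => i; rewrite edge_sym; congr andb.
by apply: eq_forallb => j; rewrite (eq_sym (x j)).
Qed.

Fact box_pow_irr : irreflexive e.
Proof. by move=> x; apply/existsP=> -[i]; rewrite edge_irr. Qed.

Definition box_pow : sgraph := SGraph box_pow_sym box_pow_irr.
End BoxPower.

Definition hypercube (s : nat) : sgraph := box_pow (path_graph 2) s.

(* Such graphs are connected: hypercubes are, and the distance in a
   disconnected graph takes the value [None]. *)
Definition partial_cube (G : sgraph) : Prop :=
  exists n (H : subgraph (hypercube n)), isometric H /\ graph_iso G H.

(** * The graphs [B r s] *)

Definition B (r s : nat) : sgraph := box (box_pow (path_graph 3) r) (hypercube s).

Definition coord (r s : nat) (x : B r s) (k : 'I_r + 'I_s) : nat :=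
  match k with
  | inl i => (x.1 : {ffun 'I_r -> 'I_3}) i
  | inr j => (x.2 : {ffun 'I_s -> 'I_2}) j
  end.

Lemma edge_BP (r s : nat) (x y : B r s) :
  edge x y <->
  exists k, (coord x k = (coord y k).+1 \/ coord y k = (coord x k).+1) /\
            forall l, l <> k -> coord x l = coord y l.
Proof.
split.
  case/orP=> /andP[].
    case/existsP=> i /andP[xyi /forallP xyj] /eqP xy2; exists (inl i).
    split=> [|[j|j] ne_jk] /=; last by rewrite xy2.
      by case/orP: xyi => /eqP /=; auto.
    have /implyP/(_ _)/eqP-> // := xyj j.
    by apply/eqP=> eq_ji; case: ne_jk; rewrite eq_ji.
  move=> /eqP xy1 /existsP[i /andP[xyi /forallP xyj]]; exists (inr i).
  split=> [|[j|j] ne_jk] /=; last 2 first.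
  - by rewrite xy1.
  - have /implyP/(_ _)/eqP-> // := xyj j.
    by apply/eqP=> eq_ji; case: ne_jk; rewrite eq_ji.
  by case/orP: xyi => /eqP /=; auto.
case=> -[i|i] [xyi xyj]; apply/orP; [left | right]; apply/andP; split.
- apply/existsP; exists i; apply/andP; split.
    by apply/orP; case: xyi => /= ->; [right | left].
  apply/forallP=> j; apply/implyP=> /eqP ne_ji; apply/eqP/val_inj.
  by apply: (xyj (inl j)) => -[].
- by apply/eqP/ffunP=> j; apply: val_inj; apply: (xyj (inr j)).
- by apply/eqP/ffunP=> j; apply: val_inj; apply: (xyj (inl j)).
- apply/existsP; exists i; apply/andP; split.
    by apply/orP; case: xyi => /= ->; [right | left].
  apply/forallP=> j; apply/implyP=> /eqP ne_ji; apply/eqP/val_inj.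
  by apply: (xyj (inr j)) => -[].
Qed.

Definition corner (r s : nat) (x : B r s) : Prop :=
  forall i : 'I_r, coord x (inl i) = 0 \/ coord x (inl i) = 2.

Definition B_minus (r s : nat) (x y : B r s) : subgraph (B r s) :=
  induced (~: [set x; y]).

(* Main.v *)
Require Import Defs.
From mathcomp Require Import all_boot.
From mathcomp Require Import zify.

(** Suppose that r + s >= 4 and that x is not a corner, so that the coordinate
    of x in some direction i is 1; let p and q be the two neighbours of x on
    the line in that direction.

    If y differs from x in some direction j other than i, choose two further
    directions k and l, which is where r + s >= 4 is used.  The P_3 x Q_2
    through x spanned by i, k and l avoids y, so B - {x, y} contains P_3 x Q_2
    minus its centre x.  This cannot happen in a partial cube
    ([not_partial_cube_block]).  In a hypercube, opposite edges of a 4-cycle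
    flip the same coordinate, so the edges from p and from q in direction l
    flip the same one: a ladder of 4-cycles leads from one to the other around
    the hole.  Their far ends have a common neighbour, hence so have the images
    of p and q in the hypercube, by translation.  By isometry p and q are at
    distance at most 2 in B - {x, y}, whereas x is their only common neighbour
    in B.

    Hence, for every direction i in which x has coordinate 1, y agrees with x
    outside i.  As x != y, there is only one such i, y is x shifted by one in
    direction i, and y is a corner.  Then B - {x, y} is isometric
    ([isometric_B_minus]): of two distinct remaining vertices u and v, the
    first can always take a step towards the second.  If they differ in two
    directions, there are two such steps, and they cannot be blocked by x and
    y, because the two blocked vertices would differ in two directions.  If
    they differ in one direction, the only step is blocked only when it lands
    on the middle of a line with ends u and v; that middle is x, and then y is
    an end of that line, which is excluded.

    So B - {x, y} is isometric whenever it is a partial cube, contrary to the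
    hypothesis; the case where y is not a corner is symmetric. *)

Set Implicit Arguments.
Unset Strict Implicit.
Unset Printing Implicit Defensive.

(** * Hypercubes and partial cubes *)

(** Bits turn vertices of a hypercube into vectors over F_2, in which translation
    is coordinatewise exclusive or. *)
Definition bit n (a : hypercube n) (j : 'I_n) : bool :=
  odd ((a : {ffun 'I_n -> 'I_2}) j).

Lemma bit_inj n (a b : hypercube n) : bit a =1 bit b -> a = b.
Proof.
move=> ab; apply/ffunP=> j; apply: val_inj; move: (ab j); rewrite /bit.
by case: (a j) => [[|[|?]] ?]; case: (b j) => [[|[|?]] ?].
Qed.

Definition cube_of_bits n (g : 'I_n -> bool) : hypercube n :=
  [ffun j => if g j then Ordinal (isT : 1 < 2) else Ordinal (isT : 0 < 2)].

Lemma bit_cube_of_bits n (g : 'I_n -> bool) : bit (cube_of_bits g) =1 g.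
Proof. by move=> j; rewrite /bit ffunE; case: (g j). Qed.

Lemma cube_edgeP n (a b : hypercube n) :
  edge a b <-> exists i, forall j, bit a j (+) bit b j = (j == i).
Proof.
split=> [/existsP[i /andP[abi /forallP abj]] | [i abi]].
  exists i => j; rewrite /bit; have [->|ne_ji] := eqVneq j i.
    by move: abi; case: (a i) => [[|[|?]] ?]; case: (b i) => [[|[|?]] ?].
  by have /implyP/(_ ne_ji)/eqP-> := abj j; rewrite addbb.
apply/existsP; exists i; apply/andP; split.
  move: (abi i); rewrite eqxx /bit.
  by case: (a i) => [[|[|?]] ?]; case: (b i) => [[|[|?]] ?].
apply/forallP=> j; apply/implyP=> /negPf ne_ji; apply/eqP/val_inj.
move: (abi j); rewrite ne_ji /bit.
by case: (a j) => [[|[|?]] ?]; case: (b j) => [[|[|?]] ?].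
Qed.

(** Opposite edges of a 4-cycle flip the same coordinate.  The four flipped
    coordinates cancel in pairs around the cycle; as a != c and b != d, the
    flip of ab is neither that of bc nor that of ad. *)
Lemma cube_square n (a b c d : hypercube n) :
  edge a b -> edge b c -> edge d c -> edge a d -> a != c -> b != d ->
  forall j, bit a j (+) bit b j = bit d j (+) bit c j.
Proof.
move=> /cube_edgeP[i ab] /cube_edgeP[j bc] /cube_edgeP[k dc] /cube_edgeP[l ad].
move=> ne_ac ne_bd.
have ne_ij : i != j.
  apply: contra ne_ac => /eqP eq_ij; apply/eqP/bit_inj => t.
  by move: (ab t) (bc t); rewrite eq_ij => <-; do 3!case: bit.
have ne_il : i != l.
  apply: contra ne_bd => /eqP eq_il; apply/eqP/bit_inj => t.
  by move: (ab t) (ad t); rewrite eq_il => <-; do 3!case: bit.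
suff eq_ik : i = k by move=> t; rewrite ab dc eq_ik.
apply/eqP; move: (ab i) (bc i) (dc i) (ad i).
rewrite eqxx (negPf ne_ij) (negPf ne_il).
by case: (i == k); do 4!case: bit.
Qed.

Lemma walkP (G : sgraph) (n : nat) (u v : G) :
  reflect (exists p, [/\ size p = n, path (@edge G) u p & v = last u p])
          (walk n u v).
Proof.
apply: (iffP existsP) => [[p /andP[up /eqP v_last]] | [p [<- up ->]]].
  by exists p; rewrite size_tuple.
by exists (in_tuple p); rewrite /= up eqxx.
Qed.

(** The isometry of the embedding is only needed at distance at most 2; the
    midpoint w of a path in the hypercube need not lie in the image. *)
Lemma partial_cube_embedding (G : sgraph) :
  partial_cube G ->
  exists n (f : G -> hypercube n),
    [/\ injective f, forall u v, edge u v -> edge (f u) (f v) &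
        forall u v w, edge (f u) w -> edge w (f v) ->
          [\/ u = v, edge u v | exists2 z, edge u z & edge z v]].
Proof.
case=> n [K [isoK [g [h gK hK] gE]]]; exists n, (fun u => val (g u)).
split=> [u v /val_inj/(can_inj gK) // | u v | u v w /= uw wv].
  by rewrite -gE => /sedge_sub/and3P[].
have w2 : walk 2 (val (g u)) (val (g v)).
  by apply/walkP; exists [:: w; val (g v)]; rewrite /= uw wv.
case Em: (dist (val (g u)) (val (g v))) => [m|]; last first.
  by move/dist_NoneP: Em => /(_ 2); rewrite w2.
have /dist_SomeP[_ /(_ _ w2) le_m2] := Em.
move: Em; rewrite -isoK => /dist_SomeP[/walkP[p [szp up v_last]] _].
case: p => [|z [|z' [|? ?]]] /= in szp up v_last; last by move: le_m2; rewrite -szp.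
- by constructor 1; apply: (can_inj gK).
- by constructor 2; rewrite -gE v_last; case/andP: up.
case/and3P: up => uz zv _; constructor 3; exists (h z).
  by rewrite -gE hK.
by rewrite -gE hK v_last.
Qed.

(** Edges are ordered pairs of ends here; a path for this relation is a ladder
    of 4-cycles whose rungs are the edges along the path. *)
Definition square (G : sgraph) : rel (G * G) := fun e e' =>
  [&& edge e.1 e.2, edge e'.1 e'.2, edge e.1 e'.1, edge e.2 e'.2,
      e.1 != e'.2 & e.2 != e'.1].

(** All rungs of a ladder are embedded as parallel edges of the hypercube, so the
    path b, z, b' is translated by the rung ab onto a path from a to a'. *)
Lemma partial_cube_ladder (G : sgraph) (a b a' b' z : G) :
  partial_cube G -> connect (@square G) (a, b) (a', b') ->
  edge b z -> edge z b' ->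
  [\/ a = a', edge a a' | exists2 w, edge a w & edge w a'].
Proof.
case/partial_cube_embedding=> n [f [f_inj fE f_two]] /connectP[s ab_s a'b'] bz zb'.
have parallel j : bit (f a) j (+) bit (f b) j = bit (f a') j (+) bit (f b') j.
  rewrite -[a']/(a', b').1 -[b' in RHS]/(a', b').2 a'b'.
  elim: s a b {bz a'b'} ab_s => //= -[c d] s IHs a b /andP[sq /IHs <-] /=.
  case/and5P: sq => /= ab cd ac bd /andP[ne_ad ne_bc].
  by apply: cube_square; rewrite ?fE ?(inj_eq f_inj).
(* the translate of z by the common flip of the rungs *)
pose w := cube_of_bits (fun j => bit (f a) j (+) bit (f b) j (+) bit (f z) j).
apply: (f_two a a' w).
  have /cube_edgeP[i bzi] := fE _ _ bz; apply/cube_edgeP; exists i => j.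
  by rewrite -bzi bit_cube_of_bits; do 3!case: bit.
have /cube_edgeP[i zbi] := fE _ _ zb'; apply/cube_edgeP; exists i => j.
by rewrite -zbi bit_cube_of_bits parallel; do 3!case: bit.
Qed.

(** * Isometric subgraphs *)

(** A function D that changes by at most 1 along an edge of G bounds distances
    in G from below; if it can be decreased inside H, it bounds them from above
    in H.  Both distances are then equal to D. *)
Lemma isometric_descent (G : sgraph) (H : subgraph G) (D : G -> G -> nat) :
  (forall v, D v v = 0) ->
  (forall u w v, edge u w -> D u v <= (D w v).+1) ->
  (forall u v, D u v = 0 -> u = v) ->
  (forall u v : H, u != v ->
     exists2 w : H, edge u w & D (val u) (val v) = (D (val w) (val v)).+1) ->
  isometric H.
Proof.
move=> D0 D_lip D_eq0 D_desc u v.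
have walk_min m (a b : G) : walk m a b -> D a b <= m.
  case/walkP=> p [<- ap ->]; elim: p a ap => [|c p IHp] a /=; first by rewrite D0.
  by case/andP=> ac /IHp le_cp; apply: leq_trans (D_lip _ _ _ ac) _.
have walk_val m (a b : H) : walk m a b -> walk m (val a) (val b).
  case/walkP=> p [<- ap ->]; apply/walkP; exists (map val p).
  rewrite size_map last_map; split=> //; rewrite path_map.
  by apply: sub_path ap => c d /sedge_sub/and3P[].
have walk_D : walk (D (val u) (val v)) u v.
  move Em: (D _ _) => m; elim: m u Em => [|m IHm] u Em.
    by apply/walkP; exists [::]; split=> //; apply/val_inj/esym/D_eq0.
  have [eq_uv | /D_desc[w uw]] := eqVneq u v; first by rewrite eq_uv D0 in Em.
  rewrite Em => -[/esym /IHm/walkP[p [<- wp ->]]].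
  by apply/walkP; exists (w :: p); split=> //; apply/andP.
transitivity (Some (D (val u) (val v))).
  by apply/dist_SomeP; split=> // m /walk_val/walk_min.
by apply/esym/dist_SomeP; split=> [|m /walk_min //]; apply: walk_val.
Qed.

(** * Coordinates, steps and the l1 distance *)

Section Coordinates.
Variables r s : nat.
Implicit Types (u v w x y : B r s) (k : 'I_r + 'I_s) (g : 'I_r + 'I_s -> nat).

Definition top k : nat := if k is inl _ then 2 else 1.

Lemma coord_le_top u k : coord u k <= top k.
Proof. by case: k => i /=; rewrite -ltnS. Qed.

Lemma coord_inj u v : coord u =1 coord v -> u = v.
Proof.
case: u v => [u1 u2] [v1 v2] uv; congr pair; apply/ffunP=> i; apply: val_inj.
  exact: (uv (inl i)).
exact: (uv (inr i)).
Qed.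

Definition of_coord g : B r s :=
  ([ffun i => inord (g (inl i))] : {ffun 'I_r -> 'I_3},
   [ffun j => inord (g (inr j))] : {ffun 'I_s -> 'I_2}).

Lemma of_coordK g : (forall k, g k <= top k) -> coord (of_coord g) =1 g.
Proof.
move=> g_top [i|i] /=; rewrite ffunE inordK // ltnS; first exact: (g_top (inl i)).
exact: (g_top (inr i)).
Qed.

(** The subtraction is truncated, so each summand is an absolute difference. *)
Definition l1 u v : nat :=
  \sum_k ((coord u k - coord v k) + (coord v k - coord u k)).

Lemma l1_eq0 u v : l1 u v = 0 -> u = v.
Proof.
move/eqP; rewrite sum_nat_eq0 => /forallP uv; apply: coord_inj => k.
by have /implyP/(_ isT) := uv k; lia.
Qed.

Lemma l1_lipschitz u w v : edge u w -> l1 u v <= (l1 w v).+1.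
Proof.
case/edge_BP=> k [uwk uwl]; rewrite /l1 (bigD1 k) //= [X in _ <= X.+1](bigD1 k) //=.
rewrite (eq_bigr (fun l => (coord w l - coord v l) + (coord v l - coord w l))).
  by case: uwk; lia.
by move=> l /eqP/uwl ->.
Qed.

Definition step u k (c : nat) : B r s :=
  of_coord (fun l => if l == k then c else coord u l).

Lemma coord_step u k c : c <= top k ->
  coord (step u k c) =1 (fun l => if l == k then c else coord u l).
Proof.
move=> le_c; apply: of_coordK => l.
by case: eqP => [->|_] //; apply: coord_le_top.
Qed.

(** The step from u in direction k that decreases the distance to v; meaningful
    only if u and v differ in direction k. *)
Definition toward u v k : B r s :=
  step u k (if coord u k < coord v k then (coord u k).+1 else (coord u k).-1).

Lemma coord_toward u v k :
  coord (toward u v k) =1 (fun l => if l == k then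
    (if coord u k < coord v k then (coord u k).+1 else (coord u k).-1)
    else coord u l).
Proof.
by apply: coord_step; move: (coord_le_top u k) (coord_le_top v k); case: ltnP; lia.
Qed.

Lemma edge_toward u v k : coord u k != coord v k -> edge u (toward u v k).
Proof.
move=> ne_k; apply/edge_BP; exists k; split=> [|l /eqP/negPf ne_lk].
  by rewrite coord_toward eqxx; case: ltnP; lia.
by rewrite coord_toward ne_lk.
Qed.

Lemma l1_toward u v k :
  coord u k != coord v k -> l1 u v = (l1 (toward u v k) v).+1.
Proof.
move=> ne_k; rewrite /l1 (bigD1 k) //= [in RHS](bigD1 k) //=.
rewrite [in RHS](eq_bigr (fun l => (coord u l - coord v l) + (coord v l - coord u l))).
  by rewrite coord_toward eqxx; case: ltnP; lia.
by move=> l /negPf ne_lk; rewrite coord_toward ne_lk.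
Qed.

Lemma ex_coord_neq u v : u != v -> exists k, coord u k != coord v k.
Proof.
move=> ne_uv; apply/existsP; apply: contraNT ne_uv; rewrite negb_exists => /forallP uv.
by apply/eqP/coord_inj => k; apply/eqP/negPn.
Qed.

Lemma coord_toward_off u v k l : l != k -> coord (toward u v k) l = coord u l.
Proof. by move=> /negPf ne_lk; rewrite coord_toward ne_lk. Qed.

Lemma coord_toward_neq u v k :
  coord u k != coord v k -> coord (toward u v k) k != coord u k.
Proof. by move=> ne_k; rewrite coord_toward eqxx; case: ltnP; lia. Qed.

(** A step that does not reach the target in its direction lands on the middle
    of a factor P_3 whose two ends are the coordinates of u and v. *)
Lemma toward_mid u v k :
  coord u k != coord v k -> coord (toward u v k) k != coord v k ->
  [/\ exists i, k = inl i, coord (toward u v k) k = 1 &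
      forall c, c <= top k -> c != 1 -> c = coord u k \/ c = coord v k].
Proof.
move=> ne_k; rewrite coord_toward eqxx.
move: (coord_le_top u k) (coord_le_top v k) => le_u le_v ne_wv.
have [k2 wk] : top k = 2 /\ coord u k + coord v k = 2.
  by case: (k) ne_k ne_wv le_u le_v => ? /=; case: ltnP; lia.
split; [by case: (k) k2 => // i; exists i | by case: ltnP; lia | move=> c; lia].
Qed.

(** * Isometry when y is next to x *)

Lemma in_B_minus x y u : (u \in sverts (B_minus x y)) = (u != x) && (u != y).
Proof. by rewrite !inE negb_or. Qed.

Lemma notin_B_minus x y u : (u \notin sverts (B_minus x y)) = (u == x) || (u == y).
Proof. by rewrite !inE negbK. Qed.

Lemma edge_B_minus x y (u v : B_minus x y) : edge u v = edge (val u) (val v).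
Proof. by rewrite /edge /= (valP u) (valP v). Qed.

(** The hypothesis on y says that whenever x can be the middle of a line, y lies
    on that line. *)
Lemma ex_toward_B_minus x y i u v :
  coord x (inl i) = 1 -> x != y ->
  (forall i' (j : 'I_r + 'I_s),
     coord x (inl i') = 1 -> j != inl i' -> coord x j = coord y j) ->
  u \in sverts (B_minus x y) -> v \in sverts (B_minus x y) -> u != v ->
  exists2 k, coord u k != coord v k & toward u v k \in sverts (B_minus x y).
Proof.
move=> xi ne_xy xy_off uH vH /ex_coord_neq[k ne_k].
have ne_i : coord x (inl i) != coord y (inl i).
  have [j] := ex_coord_neq ne_xy; have [-> //|ne_ji] := eqVneq j (inl i).
  by rewrite (xy_off i j) ?eqxx.
have [wH|] := boolP (toward u v k \in sverts (B_minus x y)); first by exists k.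
rewrite notin_B_minus => wxy.
case: (boolP [exists l : 'I_r + 'I_s, (l != k) && (coord u l != coord v l)]).
  case/existsP=> l /andP[ne_lk ne_l]; exists l => //.
  apply/negPn; rewrite notin_B_minus; apply/negP=> wxy'.
  have ne_kl : k != l by rewrite eq_sym.
  (* both steps are blocked, by different vertices: these are x and y, and they
     differ in the directions k and l *)
  have [xy_k xy_l] : coord x k != coord y k /\ coord x l != coord y l.
    move: (coord_toward_neq ne_k) (coord_toward_neq ne_l).
    rewrite -(coord_toward_off u v ne_kl) -(coord_toward_off u v ne_lk).
    by case/orP: wxy => /eqP ->; case/orP: wxy' => /eqP ->;
      rewrite ?eqxx // => ? ?; split; rewrite // eq_sym.
  have ki : k = inl i by apply/eqP; apply: contraNT xy_k => /(xy_off _ _ xi) ->.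
  have li : l = inl i by apply/eqP; apply: contraNT xy_l => /(xy_off _ _ xi) ->.
  by rewrite ki li eqxx in ne_lk.
(* u and v differ in direction k only *)
rewrite negb_exists => /forallP uv; exfalso.
have {}uv (l : 'I_r + 'I_s) : l != k -> coord v l = coord u l.
  by move=> ne_lk; apply/esym/eqP; move: (uv l); rewrite ne_lk negbK.
have ne_wk : coord (toward u v k) k != coord v k.
  apply: contraTneq vH => wvk; rewrite notin_B_minus.
  suff <- : toward u v k = v by [].
  apply: coord_inj => l; have [->//|ne_lk] := eqVneq l k.
  by rewrite coord_toward_off // uv.
have [[i' ki'] wk1 other] := toward_mid ne_k ne_wk.
case/orP: wxy => /eqP w_eq; rewrite w_eq ki' in wk1.
  (* x is the middle of the line with ends u and v, so y is one of these ends *)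
  have ii' : inl i = inl i' :> 'I_r + 'I_s.
    by apply/eqP; apply: contraNT ne_i => ne_ii'; rewrite (xy_off i').
  have y_off (l : 'I_r + 'I_s) : l != k -> coord y l = coord u l.
    move=> ne_lk; have <- : coord x l = coord y l.
      by apply: (xy_off i') => //; rewrite -ki'.
    by rewrite -w_eq coord_toward_off.
  have [||yu|yv] := other (coord y k); first exact: coord_le_top.
  - by rewrite ki' -ii' eq_sym -xi.
  - suff yu' : y = u by rewrite in_B_minus yu' eqxx andbF in uH.
    by apply: coord_inj => l; have [->//|ne_lk] := eqVneq l k; rewrite y_off.
  - suff yv' : y = v by rewrite in_B_minus yv' eqxx andbF in vH.
    by apply: coord_inj => l; have [->//|ne_lk] := eqVneq l k; rewrite y_off // uv.
(* y has the coordinate 1 in a direction other than i; x then has it as well,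
   and y should agree with x in direction i *)
have ne_ii' : inl i' != inl i :> 'I_r + 'I_s.
  by apply: contraNneq ne_i => eq_ii'; rewrite xi -eq_ii' wk1.
case/eqP: ne_i; apply: (xy_off i'); last by rewrite eq_sym.
by rewrite (xy_off i).
Qed.

Lemma isometric_B_minus x y i :
  coord x (inl i) = 1 -> x != y ->
  (forall i' (j : 'I_r + 'I_s),
     coord x (inl i') = 1 -> j != inl i' -> coord x j = coord y j) ->
  isometric (B_minus x y).
Proof.
move=> xi ne_xy xy_off; apply: (isometric_descent (D := l1)).
- by move=> v; rewrite /l1 big1 // => k _; rewrite subnn.
- exact: l1_lipschitz.
- exact: l1_eq0.
move=> u v ne_uv.
have [k ne_k wH] := ex_toward_B_minus xi ne_xy xy_off (valP u) (valP v) ne_uv.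
exists (exist (fun z => z \in sverts (B_minus x y)) _ wH); last exact: l1_toward.
by rewrite edge_B_minus edge_toward.
Qed.

(** * The product of P_3 and a square without its centre *)

(** A neighbour of m that stays in range both in {0, 1} and in {0, 1, 2}. *)
Definition flip (m : nat) : nat := if m is m'.+1 then m' else 1.

Section Block.
Variables (x y : B r s) (i : 'I_r) (j k l : 'I_r + 'I_s).
Hypotheses (xi : coord x (inl i) = 1) (xyj : coord x j != coord y j).
Hypothesis uniq_ijkl : uniq [:: inl i; j; k; l].

Definition flip_if (b : bool) (m : nat) : nat := if b then flip m else m.

(** The vertices of the P_3 x Q_2 through x in the directions i, k and l; its
    centre x is [block 1 false false], and [block 0 false false] and
    [block 2 false false] are the neighbours of x in direction i. *)
Definition block (a : nat) (b c : bool) : B r s :=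
  step (step (step x l (flip_if c (coord x l))) k (flip_if b (coord x k))) (inl i) a.

Lemma coord_block a b c : a <= 2 -> coord (block a b c) =1 (fun t =>
  if t == inl i then a else
  if t == k then flip_if b (coord x k) else
  if t == l then flip_if c (coord x l) else coord x t).
Proof.
have flip_top d t : flip_if d (coord x t) <= top t.
  case: d; last exact: coord_le_top.
  by move: (coord_le_top x t); case: (coord x t) => [|?] /=; case: t => ? /=; lia.
by move=> le_a2 t; rewrite !coord_step.
Qed.

Lemma flip_adjacent m : m = (flip m).+1 \/ flip m = m.+1.
Proof. by case: m => [|m]; [right | left]. Qed.

Lemma uniq_neq :
  [/\ (j == inl i) = false, (j == k) = false & (j == l) = false] /\
  [/\ (k == inl i) = false, (l == inl i) = false & (l == k) = false].
Proof.
move: uniq_ijkl; rewrite /= !inE !negb_or.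
rewrite !(eq_sym _ (inl i)) !(eq_sym _ k) (eq_sym _ l).
by do !case: eqP.
Qed.

Lemma edge_block_i a b c : a <= 1 -> edge (block a b c) (block a.+1 b c).
Proof.
move=> le_a1; apply/edge_BP; exists (inl i); split=> [|t /eqP/negPf ne_ti].
  by rewrite !coord_block ?eqxx //; [right | lia].
by rewrite !coord_block ?ne_ti //; lia.
Qed.

Lemma edge_block_k a b c : a <= 2 -> edge (block a b c) (block a (~~ b) c).
Proof.
have [_ [ki _ _]] := uniq_neq.
move=> le_a2; apply/edge_BP; exists k; split=> [|t /eqP/negPf ne_tk].
  rewrite !coord_block // ki eqxx; have := flip_adjacent (coord x k).
  by case: b; tauto.
by rewrite !coord_block ?ne_tk.
Qed.

Lemma edge_block_l a b : a <= 2 -> edge (block a b false) (block a b true).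
Proof.
have [_ [_ li lk]] := uniq_neq.
move=> le_a2; apply/edge_BP; exists l; split=> [|t /eqP/negPf ne_tl].
  by rewrite !coord_block // li lk eqxx /=; have := flip_adjacent (coord x l); tauto.
by rewrite !coord_block ?ne_tl.
Qed.

Lemma block_neq a b a' b' : a <= 2 -> a' <= 2 -> block a b false != block a' b' true.
Proof.
have [_ [_ li lk]] := uniq_neq.
move=> le_a2 le_a'2; apply/eqP=> /(congr1 (fun u => coord u l)).
by rewrite !coord_block // li lk eqxx /flip_if; case: (flip_adjacent (coord x l)); lia.
Qed.

(** Only x is missing from the block: y differs from all of it in direction j. *)
Lemma in_block a b c :
  a <= 2 -> [|| a != 1, b | c] -> block a b c \in sverts (B_minus x y).
Proof.
have [[ji jk jl] [ki li lk]] := uniq_neq.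
move=> le_a2 abc; rewrite in_B_minus; apply/andP; split; last first.
  by apply: contraNneq xyj => <-; rewrite coord_block // ji jk jl.
apply: contraTneq abc => bx; rewrite !negb_or negbK.
move: (congr1 (fun u => coord u (inl i)) bx).
move: (congr1 (fun u => coord u k) bx) (congr1 (fun u => coord u l) bx).
rewrite !coord_block // ki li lk !eqxx xi /flip_if => + + ->.
by case: (b) (c) (flip_adjacent (coord x k)) (flip_adjacent (coord x l)) => [] []; lia.
Qed.

Lemma block_common_neighbour (z : B r s) : edge (block 0 false false) z ->
  edge z (block 2 false false) -> z = x.
Proof.
case/edge_BP=> k1 [pz_k1 pz_off] /edge_BP[k2 [zq_k2 zq_off]].
have k1i : k1 = inl i.
  apply/eqP; apply: contraT => /eqP/nesym ne_k1; move: (pz_off _ ne_k1) zq_k2 zq_off.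
  have [->|/eqP/nesym ne_k2] := eqVneq k2 (inl i).
    by rewrite !coord_block ?eqxx // => <- [].
  by move=> + _ /(_ _ ne_k2); rewrite !coord_block ?eqxx // => <-.
have k2i : k2 = inl i.
  apply/eqP; apply: contraT => /eqP/nesym ne_k2; move: (zq_off _ ne_k2) pz_k1.
  by rewrite k1i !coord_block ?eqxx //; lia.
move: pz_k1 zq_k2; rewrite k1i k2i !coord_block ?eqxx // => pz zq.
apply: coord_inj => t; have [->|ne_t] := eqVneq t (inl i).
  by rewrite xi; case: pz.
rewrite -pz_off; last by rewrite k1i; apply/eqP.
rewrite coord_block // (negPf ne_t).
by case: eqP => [->//|_]; case: eqP => [->|].
Qed.

(** A ladder with rungs in direction l leads from one neighbour of x in
    direction i to the other, around the rung at x, which is missing.  The far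
    ends of its extreme rungs have the common neighbour x + e_l, so these two
    neighbours of x should have one as well, and x is no longer there. *)
Lemma not_partial_cube_block : ~ partial_cube (B_minus x y).
Proof.
move=> cubeH; pose u0 : B_minus x y :=
  exist (fun z => z \in sverts (B_minus x y)) _ (@in_block 0 false false isT isT).
pose W a b c : B_minus x y := insubd u0 (block a b c).
have val_W a b c : a <= 2 -> [|| a != 1, b | c] -> val (W a b c) = block a b c.
  by move=> le_a2 abc; rewrite val_insubd in_block.
have W_edge a b c a' b' c' :
    a <= 2 -> a' <= 2 -> [|| a != 1, b | c] -> [|| a' != 1, b' | c'] ->
    edge (block a b c) (block a' b' c') -> edge (W a b c) (W a' b' c').
  by move=> ? ? ? ?; rewrite edge_B_minus !val_W.
have W_neq a b a' b' : a <= 2 -> a' <= 2 -> [|| a != 1, b | false] ->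
    W a b false != W a' b' true.
  move=> le_a le_a' ab; apply/eqP=> /(congr1 val); rewrite !val_W ?orbT //.
  by apply/eqP/block_neq.
have W_square a b a' b' : a <= 2 -> a' <= 2 -> (a != 1) || b -> (a' != 1) || b' ->
    (forall c, edge (block a b c) (block a' b' c)) ->
    connect (@square (B_minus x y))
      (W a b false, W a b true) (W a' b' false, W a' b' true).
  move=> le_a le_a' ab ab' bb'.
  have ex d b1 c : (d != 1) || b1 -> [|| d != 1, b1 | c].
    by rewrite orbA => ->.
  apply/connect1/and5P; split; last (apply/andP; split; last rewrite eq_sym);
    by [apply: W_edge; rewrite ?ex ?edge_block_l | apply: W_neq; rewrite ?ex].
have ladder : connect (@square (B_minus x y))
    (W 0 false false, W 0 false true) (W 2 false false, W 2 false true).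
  apply: connect_trans (W_square 0 false 0 true _ _ _ _ _) _ => //.
    by move=> c; apply: edge_block_k.
  apply: connect_trans (W_square 0 true 1 true _ _ _ _ _) _ => //.
    by move=> c; apply: edge_block_i.
  apply: connect_trans (W_square 1 true 2 true _ _ _ _ _) _ => //.
    by move=> c; apply: edge_block_i.
  by apply: W_square => // c; apply: (@edge_block_k 2 true).
case: (partial_cube_ladder (z := W 1 false true) cubeH ladder).
- by apply: W_edge => //; apply: edge_block_i.
- by apply: W_edge => //; apply: edge_block_i.
- move/(congr1 val); rewrite !val_W // => /(congr1 (fun u => coord u (inl i))).
  by rewrite !coord_block ?eqxx.
- rewrite edge_B_minus !val_W // => /edge_BP[t [pq_t pq_off]].
  have [ti|/eqP/nesym/pq_off] := eqVneq t (inl i).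
    by move: pq_t; rewrite ti !coord_block ?eqxx //; lia.
  by rewrite !coord_block ?eqxx.
- case=> z; rewrite !edge_B_minus !val_W // => pz /(block_common_neighbour pz) zx.
  by move: (valP z); rewrite in_B_minus zx eqxx.
Qed.

End Block.

Lemma ex_two_directions (i j : 'I_r + 'I_s) : 3 < r + s -> i != j ->
  exists k l : 'I_r + 'I_s, uniq [:: i; j; k; l].
Proof.
move=> lt_rs ne_ij.
have : 1 < #|~: [set i; j]|.
  by rewrite cardsCs setCK cards2 card_sum !card_ord ne_ij; lia.
case/card_gt1P=> k [l [+ + ne_kl]]; rewrite !inE !negb_or => /andP[ki kj] /andP[li lj].
exists k, l; rewrite /= !inE !negb_or ne_ij ne_kl.
by rewrite !(eq_sym i) !(eq_sym j) ki kj li lj.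
Qed.

End Coordinates.

(** * The theorem *)

Lemma noncorner_B_minus r s (x y : B r s) :
  3 < r + s -> x != y -> ~ corner x -> partial_cube (B_minus x y) ->
  isometric (B_minus x y).
Proof.
move=> lt_rs ne_xy not_corner cubeH.
have /existsP[i /eqP xi] : [exists i : 'I_r, coord x (inl i) == 1].
  apply: contra_notT not_corner; rewrite negb_exists => /forallP x_ne1 i.
  by move: (x_ne1 i) (coord_le_top x (inl i)) => /=; lia.
apply: (isometric_B_minus xi ne_xy) => i' j xi' ne_j.
apply/eqP; apply: contraT => ne_xyj; case: notF; rewrite eq_sym in ne_j.
have [k [l uniq_ijkl]] := ex_two_directions lt_rs ne_j.
by case: (not_partial_cube_block xi' ne_xyj uniq_ijkl).
Qed.

Theorem lemma21 (r s : nat) (x y : B r s) :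
  x != y ->
  ~ corner x \/ ~ corner y ->
  sverts (B_minus x y) != set0 ->
  ~ isometric (B_minus x y) ->
  partial_cube (B_minus x y) ->
  r + s <= 3.
Proof.
move=> ne_xy not_corners _ not_iso cubeH; rewrite leqNgt; apply/negP=> lt_rs.
apply: not_iso; case: not_corners => [not_cx|not_cy].
  exact: noncorner_B_minus.
have swap : B_minus x y = B_minus y x by rewrite /B_minus setUC.
by rewrite swap in cubeH *; apply: noncorner_B_minus; rewrite // eq_sym.
Qed.
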